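(* Let $N\ge1$ be an integer, $p=2N+1$, $v\in\mathbb{R}^p$, and let $H=\Delta+V$ on $\ell^2(\Gamma)$, its spectral band $\sigma_0(v)=\{\lambda_0(a):a\in[0,2]\}$, and $\mathcal{H}=\{f\in\ell^2(\Gamma): Hf=v_1f\}$ be as in the context. i) The spectral band $\sigma_0(v)$ is a flat band with $\sigma_0(v)=\{v_1\}$ (that is, $\lambda_0(a)=v_1$ for all $a\in[0,2]$, and $v_1$ is an eigenvalue of $H$) if and only if $v_{2k+1}=v_1$ for all $k\in\{1,\dots,N\}$. ii) Let $\sigma_0(v)=\{v_1\}$, and let $S$ be the shift $Sh=(h_{n+1})_{n\in\mathbb{Z}}$ for $h=(h_n)_{n\in\mathbb{Z}}\in\ell^2(\mathbb{Z})$, and $I$ the identity. Then $\mathcal{H}$ is the set of all $f=(f_{n,k})_{(n,k)\in\mathbb{Z}\times\mathbb{N}_p}\in\ell^2(\Gamma)$ for which there is $h\in\ell^2(\mathbb{Z})$ with $$(f_{n,2k+1})_{n\in\mathbb{Z}}=(-I-S)^kh,\quad k\in\{0,1,\dots,N\},\qquad (f_{n,2k})_{n\in\mathbb{Z}}=0,\quad k\in\{1,\dots,N\}.$$ iii) Let $\sigma_0(v)=\{v_1\}$. For $m\in\mathbb{Z}$ define the compactly supported functions $\psi^m=(\psi^m_{n,k})_{(n,k)\in\mathbb{Z}\times\mathbb{N}_p}\in\mathcal{H}$ by, writing $\psi_k^m=(\psi^m_{n,k})_{n\in\mathbb{Z}}$, $$\psi^m_{2k}=0,\quad k\in\{1,\dots,N\},\qquad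 \psi^m_{2k+1}=(-I-S)^ke_m,\quad k\in\{0,1,\dots,N\},$$ where $e_m=(\delta_{n,m})_{n\in\mathbb{Z}}\in\ell^2(\mathbb{Z})$. Then each $f\in\mathcal{H}$ has the form $$f=\sum_{m\in\mathbb{Z}}\widehat f_m\psi^m,\qquad \widehat f_m=f_{m,1}$$ (convergence in $\ell^2(\Gamma)$). Moreover, the mapping $f\mapsto(\widehat f_m)_{m\in\mathbb{Z}}$ is a linear isomorphism between $\mathcal{H}$ and $\ell^2(\mathbb{Z})$.
   Context: Notation: $\mathbb{N}_p=\{1,\dots,p\}$, $p=2N+1$. The Hilbert space $\ell^2(\Gamma)$ consists of $f=(f_{n,k})_{(n,k)\in\mathbb{Z}\times\mathbb{N}_p}$ with $\sum|f_{n,k}|^2<\infty$. With $f_{n,0}=f_{n,p+1}=0$ for all $n\in\mathbb{Z}$, $H=\Delta+V$ is given by $$(\Delta f)_{n,2k+1}=f_{n,2k}+f_{n-1,2k+2}+f_{n,2k+2},\quad k=0,1,\dots,N,$$ $$(\Delta f)_{n,2k}=f_{n,2k-1}+f_{n+1,2k-1}+f_{n,2k+1},\quad k=1,\dots,N,$$ $$(Vf)_{n,k}=v_kf_{n,k},\quad (n,k)\in\mathbb{Z}\times\mathbb{N}_p,\qquad v=(v_k)_{k=1}^p\in\mathbb{R}^p.$$ For $a\in[0,2]$, $J_a$ is the symmetric tridiagonal $p\times p$ matrix with diagonal $(v_1,\dots,v_p)$ and off-diagonal entries $(a,1,a,1,\dots,a,1)$ (the $(n,n+1)$ entry is $a$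 for odd $n$ and $1$ for even $n$); $\lambda_{-N}(a)\le\dots\le\lambda_N(a)$ are its eigenvalues, so $\lambda_0(a)$ is the middle one. The spectrum of $H$ is $\bigcup_{k=-N}^N\lambda_k([0,2])$. A flat band is a band reduced to a single point which is an eigenvalue of $H$ of infinite multiplicity. *)

(* Defs.v *)
From HB Require Import structures.
From mathcomp Require Import all_boot all_order all_algebra finmap.
From mathcomp Require Import spectral complex.
From mathcomp Require Import mathcomp_extra boolp classical_sets functions.
From mathcomp Require Import reals constructive_ereal ereal topology.
From mathcomp Require Import normedtype esum.
From mathcomp Require summability.

Set Implicit Arguments.
Unset Strict Implicit.
Unset Printing Implicit Defensive.
Import Order.TTheory GRing.Theory Num.Theory.
Import numFieldNormedType.Exports.
Local Open Scope classical_set_scope.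
Local Open Scope ring_scope.
Local Open Scope complex_scope.

Section ell2.
Variable R : realType.
Implicit Type I : choiceType.

(* The norm is extended-real valued, so that it is +oo (and not a junk value)
   off l^2. *)
Definition l2norm I (f : I -> R[i]) : \bar R :=
  sqrte (\esum_(x in [set: I]) (Normc.normc (f x) ^+ 2)%:E).

Definition l2 I : set (I -> R[i]) := [set f | (l2norm f < +oo)%E].

(* Unconditional convergence in l^2(I) of the series of the g m to f. *)
Definition l2_sums_to (M I : choiceType) (g : M -> I -> R[i]) (f : I -> R[i]) :=
  l2norm (fun x => f x - \sum_(m <- (F : {fset M})) g m x)
    @[F --> summability.totally] --> 0%E.

Definition lin_indep I (n : nat) (g : 'I_n -> I -> R[i]) : Prop :=
  forall c : 'I_n -> R[i],
    (forall x, \sum_(i < n) c i * g i x = 0) -> forall i, c i = 0.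

(* The operator -I - S on sequences, S being the shift (S h)_n = h_(n+1). *)
Definition negIS (h : int -> R[i]) : int -> R[i] := fun n => - h n - h (n + 1).

Definition delta (m : int) : int -> R[i] := fun n => (n == m)%:R.

End ell2.
Arguments l2 {R} I.

Section symmetric_eigenvalues.
Variable R : realType.

Definition is_eigenvalue_seq (n : nat) (A : 'M[R]_n) (s : seq R) : Prop :=
  sorted <=%O s /\ char_poly A = \prod_(x <- s) ('X - x%:P).

(* The nondecreasing sequence of the eigenvalues, repeated according to
   multiplicity; symmetric_eigenvalues_seqP shows that it is what it should be
   for a symmetric matrix. *)
Definition eigenvalues_seq (n : nat) (A : 'M[R]_n) : seq R :=
  xget [::] [set s | is_eigenvalue_seq A s].

Lemma symmetric_eigenvalues_seqP (n : nat) (A : 'M[R]_n) :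
  A^T = A -> is_eigenvalue_seq A (eigenvalues_seq A).
Proof.
move=> symA; rewrite /eigenvalues_seq.
suff [s As] : exists s, is_eigenvalue_seq A s by case: xgetP => // /(_ s).
pose toC : {rmorphism R -> R[i]} := real_complex R.
have hermA : map_mx toC A \is hermsymmx.
  apply: realsym_hermsym.
    apply/is_hermitianmxP.
    by rewrite expr0 scale1r map_trmx symA map_mx_id.
  by apply/mxOverP => i j; rewrite mxE; apply/complex_realP; exists (A i j).
have /orthomx_spectralP eA := hermitian_normalmx hermA.
have /mxOverP realD := hermitian_spectral_diag_real hermA.
move: eA realD; set P := spectralmx _; set D := spectral_diag _ => eA realD.
have Pu : P \in unitmx by exact: spectral_unit.
pose t := [seq complex.Re (D 0 i) | i <- enum 'I_n].
exists (sort <=%O t); split; first exact: sort_le_sorted.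
rewrite (perm_big t) ?perm_sort//= big_map big_enum/=.
apply: (map_poly_inj toC); rewrite rmorph_prod/= map_char_poly/=.
have -> : char_poly (map_mx toC A) = char_poly (diag_mx D).
  pose Pp := map_mx (@polyC R[i]) P.
  have Pp0 : \det Pp != 0.
    by rewrite det_map_mx polyC_eq0 -unitfE -unitmxE.
  apply: (mulfI Pp0); rewrite [RHS]mulrC /char_poly -!det_mulmx.
  rewrite /char_poly_mx mulmxBl mulmxBr scalar_mxC -!map_mxM/=.
  by rewrite {1}eA mulmxA mulKVmx.
rewrite char_poly_trig ?diag_mx_is_trig//; apply: eq_bigr => i _.
by rewrite !mxE eqxx mulr1n rmorphB/= map_polyX map_polyC/= RRe_real.
Qed.

Lemma size_eigenvalues_seq (n : nat) (A : 'M[R]_n) :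
  A^T = A -> size (eigenvalues_seq A) = n.
Proof.
move=> /symmetric_eigenvalues_seqP[_ /(congr1 (fun p : {poly R} => size p))].
by rewrite size_char_poly size_prod_XsubC => -[].
Qed.

End symmetric_eigenvalues.

Section nanoribbon.
Variables (R : realType) (N : nat).
Local Notation p := N.*2.+1.

(* {1, ..., p} is encoded by 'I_p, of elements 0, ..., p - 1: [site k] is the
   index k of {1, ..., p} (it is only used for such k). *)
Definition site (k : nat) : 'I_p := inord k.-1.

Definition Gamma : Type := (int * 'I_p)%type.

Implicit Types (f : Gamma -> R[i]) (v : 'rV[R]_p).

(* f_(n,k) for 0 <= k <= p + 1, with f_(n,0) = f_(n,p+1) = 0. *)
Definition ext0 f (n : int) (k : nat) : R[i] :=
  if (0 < k <= p)%N then f (n, site k) else 0.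

Definition Delta f : Gamma -> R[i] := fun x =>
  let n := x.1 in
  let k := (x.2).+1 in
  if odd k then ext0 f n k.-1 + ext0 f (n - 1) k.+1 + ext0 f n k.+1
  else ext0 f n k.-1 + ext0 f (n + 1) k.-1 + ext0 f n k.+1.

Definition Hop v f : Gamma -> R[i] := fun x => Delta f x + (v 0 x.2)%:C * f x.

Definition H_eigenspace v (E : R) : set (Gamma -> R[i]) :=
  [set f | l2 _ f /\ Hop v f = (fun x => E%:C * f x)].

Definition is_H_eigenvalue v (E : R) : Prop :=
  exists2 f, H_eigenspace v E f & exists x, f x != 0.

Definition infinite_multiplicity v (E : R) : Prop :=
  forall n : nat, exists g : 'I_n -> Gamma -> R[i],
    (forall i, H_eigenspace v E (g i)) /\ lin_indep g.

(* Since the indices are 0-based here, the off-diagonal entry (i, i + 1) is a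
   for even i. *)
Definition Jmx v (a : R) : 'M[R]_p := \matrix_(i, j)
  if i == j then v 0 i
  else if j == i.+1 :> nat then (if odd i then 1 else a)
  else if i == j.+1 :> nat then (if odd j then 1 else a)
  else 0.

Lemma trmx_Jmx v a : (Jmx v a)^T = Jmx v a.
Proof.
apply/matrixP => i j; rewrite !mxE eq_sym; case: eqP => [->//|_].
case: eqP => [e1|_]; case: eqP => [e2|_] //.
by have := ltnn i; rewrite {2}e1 e2 ltnS leqnSn.
Qed.

(* lambda_k(a), for -N <= k <= N. *)
Definition lambda v (k : int) (a : R) : R :=
  (eigenvalues_seq (Jmx v a))`_(`|(N%:Z + k)%R|%N).

Definition band v (k : int) : set R := lambda v k @` `[0, 2].

Definition flat_band v (k : int) : Prop :=
  exists2 E, band v k = [set E] & infinite_multiplicity v E.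

Definition psi (m : int) : Gamma -> R[i] := fun x =>
  let n := x.1 in
  let k := (x.2).+1 in
  if odd k then iter k./2 (@negIS R) (delta R m) n else 0.

(* The sequence of the coefficients f_(m,1). *)
Definition coeffs f : int -> R[i] := fun m => f (m, site 1).

End nanoribbon.
Arguments psi : clear implicits.

(* Main.v *)
Require Import Defs.
From HB Require Import structures.
From mathcomp Require Import all_boot all_order all_algebra finmap complex.
From mathcomp Require Import spectral ring lra zify.
From mathcomp Require Import boolp classical_sets functions cardinality fsbigop.
From mathcomp Require Import reals constructive_ereal ereal topology.
From mathcomp Require Import normedtype esum.
From mathcomp Require summability.

(**
Write E = v_1. Everything rests on the fact that each bond, of J_a as of the
nanoribbon, joins an odd site to an even one.

If v is equal to E at the N + 1 odd sites, the quadratic form of J_a - E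
vanishes on the space of the vectors carried by these sites. A subspace on
which the form is definite meets it trivially, so it has dimension at most N:
at most N of the 2N + 1 eigenvalues lie above E and at most N lie below
([count_eigenvalues_isotropic]). Thus the middle one is E, whatever a is
([lambda0_const]).

Conversely, if lambda_0(a) = E for all a, then det(J_a - E) vanishes for
infinitely many a, hence as a polynomial in a. It obeys the three-term
recurrence of the continuants D_k of a tridiagonal matrix, in which D_(2m) has
degree exactly 2m in a while D_(2m-1) has degree at most 2m-2. In
  D_(2m+1) = (v_(2m+1) - E) D_(2m) - D_(2m-1) = 0
comparing degrees forces v_(2m+1) = E, then D_(2m-1) = 0, and so on down to
D_1 ([continuant_eq0], [constant_of_lambda0]).

Now let v be E at the odd sites and let H f = E f. The equation at the odd
site 1 reads f_(n-1,2) + f_(n,2) = 0, so |f_(n,2)| does not depend on n and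
square summability gives f_(.,2) = 0 ([l2_antiperiodic]); repeating this at the
sites 3, 5 and so on kills all even components. The equations at the even sites
then read f_(.,2k+1) = (-I-S) f_(.,2k-1), so f is determined by its first
component h, and conversely every h in l^2(Z) gives an eigenfunction, the
[flat_state] of h ([eigenspace_flat_state]). The map from h to its flat state is
linear, and bounded because -I-S is; its inverse takes the first component. It
sends the unit vectors e_m to psi^m, so it carries the expansion of h in the
e_m to the expansion of f in the psi^m ([flat_state_expansion]).
*)

Set Implicit Arguments.
Unset Strict Implicit.
Unset Printing Implicit Defensive.
Import Order.TTheory GRing.Theory Num.Theory.
Import numFieldNormedType.Exports.
Local Open Scope classical_set_scope.
Local Open Scope ring_scope.

Local Notation normc := Normc.normc.

(** * The middle eigenvalue of a matrix with an isotropic coordinate block *)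

Lemma char_poly_conj (F : fieldType) n (P D : 'M[F]_n) : P \in unitmx ->
  char_poly (invmx P *m D *m P) = char_poly D.
Proof.
move=> Pu; pose Q := map_mx (@polyC F) P.
have Q0 : \det Q != 0 by rewrite det_map_mx polyC_eq0 -unitfE -unitmxE.
apply: (mulfI Q0); rewrite [RHS]mulrC /char_poly -!det_mulmx.
rewrite /char_poly_mx mulmxBl mulmxBr scalar_mxC -!map_mxM/=.
by rewrite -mulmxA mulKVmx.
Qed.

Section inertia.
Variable R : realType.
Local Open Scope complex_scope.
Local Open Scope sesquilinear_scope.
Local Notation C := R[i].

(** Ties the real sorted spectrum, defined by factoring the characteristic
    polynomial, to an orthonormal eigenbasis: the two diagonal forms have the
    same roots with the same multiplicities. The eigenbasis is complex because
    the spectral theorem is used for the Hermitian matrix A over R[i]. *)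
Lemma eigenvalues_seq_spectral n (A : 'M[R]_n) : A^T = A ->
  exists (P : 'M[C]_n) (d : 'I_n -> R),
    [/\ P *m P^t* = 1%:M,
        map_mx (real_complex R) A
          = P^t* *m diag_mx (\row_i (d i)%:C) *m P &
        perm_eq (eigenvalues_seq A) [seq d i | i <- enum 'I_n]].
Proof.
move=> symA; have [_ charA] := symmetric_eigenvalues_seqP symA.
pose toC : {rmorphism R -> C} := real_complex R.
have hermA : map_mx toC A \is hermsymmx.
  apply: realsym_hermsym.
    apply/is_hermitianmxP.
    by rewrite expr0 scale1r map_trmx symA map_mx_id.
  by apply/mxOverP => i j; rewrite mxE; apply/complex_realP; exists (A i j).
have /orthomx_spectralP eA := hermitian_normalmx hermA.
have /mxOverP realD := hermitian_spectral_diag_real hermA.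
have Pu := spectral_unitarymx (map_mx toC A).
have Pi := spectral_unit (map_mx toC A).
move: eA realD Pu Pi.
set P := spectralmx _; set D := spectral_diag _ => eA realD Pu Pi.
have eD : D = \row_i (complex.Re (D 0 i))%:C.
  by apply/rowP => i; rewrite mxE RRe_real.
exists P, (fun i => complex.Re (D 0 i)); split.
- by apply/unitarymxP.
- by rewrite -eD -invmx_unitary.
apply: prod_XsubC_eq; rewrite -charA; apply: (map_poly_inj toC).
rewrite map_char_poly/=.
have -> : char_poly (map_mx toC A) = char_poly (diag_mx D).
  by rewrite {1}eA char_poly_conj.
rewrite char_poly_trig ?diag_mx_is_trig// big_map big_enum/= rmorph_prod/=.
apply: eq_bigr => i _.
by rewrite !mxE eqxx mulr1n rmorphB/= map_polyX map_polyC/= RRe_real.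
Qed.

(** The eigenvectors with 0 < e * (d - E) span a space on which the form of
    e * (A - E) is positive definite; the form vanishes on the vectors supported
    in Z. If the dimensions added up to more than n, the two spaces would share
    a nonzero vector. The factor e is meant to be 1 or -1, to count the
    eigenvalues on either side of E. *)
Lemma count_eigenvalues_isotropic n (A : 'M[R]_n) (Z : {set 'I_n}) (E e : R) :
    A^T = A ->
    (forall i j, i \in Z -> j \in Z -> A i j = if i == j then E else 0) ->
  (count (fun x => 0 < e * (x - E))%R (eigenvalues_seq A) <= #|~: Z|)%N.
Proof.
move=> symA AZ.
have [P [d [PP eA /permP->]]] := eigenvalues_seq_spectral symA.
pose S := [set i | 0 < e * (d i - E)]%SET.
have -> : count (fun x => 0 < e * (x - E)) [seq d i | i <- enum 'I_n] = #|S|.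
  by rewrite cardsE cardE count_map enumT size_filter.
rewrite leqNgt; apply/negP => ltZS.
(* The kernel of M consists of the coordinates z, in the eigenbasis, of the
   vectors z *m P in both spaces: z vanishes off S, and z *m P off Z. *)
pose M := row_mx (colsub (@enum_val _ (mem (~: S)%SET)) 1%:M)
                 (colsub (@enum_val _ (mem (~: Z)%SET)) P).
have : kermx M != 0.
  rewrite kermx_eq0 /row_free neq_ltn; apply/orP; left.
  rewrite (leq_ltn_trans (rank_leq_col _))//.
  by rewrite -[X in (_ < X)%N]card_ord -(cardsC S) addnC ltn_add2r.
case/rowV0Pn => z /sub_kermxP; rewrite mul_mx_row => zM z0.
have [zS zZ] : z *m colsub (@enum_val _ (mem (~: S)%SET)) 1%:M = 0 /\
           z *m colsub (@enum_val _ (mem (~: Z)%SET)) P = 0.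
  by apply: eq_row_mx; rewrite row_mx0.
have z_S i : i \notin S -> z 0 i = 0.
  rewrite -finset.in_setC => iS; move/rowP/(_ (enum_rank_in iS i)): zS.
  by rewrite mulmx_colsub mulmx1 !mxE enum_rankK_in.
pose x := z *m P.
have x_Z i : i \notin Z -> x 0 i = 0.
  rewrite -finset.in_setC => iS; move/rowP/(_ (enum_rank_in iS i)): zZ.
  by rewrite mulmx_colsub !mxE enum_rankK_in.
have xA : x *m (map_mx (real_complex R) A - E%:C%:M) *m x^t* = 0.
  apply/matrixP => i j; rewrite !ord1 [LHS]mxE [RHS]mxE; apply: big1 => k _.
  rewrite [x^t* _ _]mxE [x^T _ _]mxE.
  have [kZ|kZ] := boolP (k \in Z); last by rewrite x_Z// conjC0 mulr0.
  rewrite mxE big1 ?mul0r// => l _.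
  have [lZ|lZ] := boolP (l \in Z); last by rewrite x_Z// mul0r.
  rewrite !mxE AZ//; case: eqP => _; last by rewrite mulr0n subr0 mulr0.
  by rewrite mulr1n subrr mulr0.
have : z *m (diag_mx (\row_i (d i)%:C) - E%:C%:M) *m z^t* = 0.
  rewrite -xA /x eA trmx_mul map_mxM !mulmxBr !mulmxBl !mulmxA; congr (_ - _).
    rewrite -(mulmxA z P) PP mulmx1.
    by rewrite -(mulmxA _ P) PP mulmx1.
  by rewrite !mul_mx_scalar -!scalemxAl -(mulmxA z) PP mulmx1.
move/matrixP/(_ 0 0); rewrite !mxE => sum0.
(* All terms of this sum are nonnegative, since z vanishes off S; hence so does
   each of them, and z vanishes on S too. *)
have sum_e : \sum_i (e * (d i - E))%:C * `|z 0 i| ^+ 2 = 0.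
  rewrite -[RHS](mulr0 e%:C) -[in RHS]sum0 mulr_sumr; apply: eq_bigr => i _.
  rewrite mulmxBr mul_mx_diag mul_mx_scalar !mxE normCK rmorphM rmorphB/=.
  ring.
have z_0 i : true -> (e * (d i - E))%:C * `|z 0 i| ^+ 2 = 0.
  apply: (psumr_eq0P _ sum_e) => {}i _.
  have [|/z_S->] := boolP (i \in S); last by rewrite normr0 expr0n mulr0.
  by rewrite inE => eiS; rewrite mulr_ge0 ?exprn_ge0// lecR ltW.
case/negP: z0; apply/eqP/rowP => i; rewrite [RHS]mxE.
have [iS|/z_S//] := boolP (i \in S).
rewrite inE in iS; have /eqP := z_0 i isT.
by rewrite mulf_eq0 sqrf_eq0 normr_eq0 gt_eqF ?ltcR//= => /eqP.
Qed.
End inertia.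

Lemma sorted_median (R : realDomainType) (N : nat) (s : seq R) (E : R) :
    sorted <=%O s -> size s = N.*2.+1 ->
    (count (fun x => 0 < x - E)%R s <= N)%N ->
    (count (fun x => x - E < 0)%R s <= N)%N ->
  s`_N = E.
Proof.
move=> s_sorted sz_s above below.
have le_s i j : (i <= j)%N -> (j < size s)%N -> s`_i <= s`_j.
  move=> le_ij lt_js; apply: (sorted_leq_nth le_trans le_refl) => //.
  by rewrite inE (leq_ltn_trans le_ij).
apply/eqP; rewrite eq_le; apply/andP; split; rewrite leNgt; apply/negP => lt_E.
- move: above; apply/negP; rewrite -ltnNge -{1}(cat_take_drop N s) count_cat.
  rewrite ltn_addl// (_ : count _ _ = size (drop N s)).
    by rewrite size_drop sz_s; lia.
  apply/eqP; rewrite -all_count; apply/(all_nthP 0) => i.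
  rewrite size_drop sz_s => lt_i; rewrite nth_drop subr_gt0.
  by rewrite (lt_le_trans lt_E)// le_s// ?sz_s; lia.
- have sz_take : size (take N.+1 s) = N.+1 by rewrite size_takel// sz_s; lia.
  move: below; apply/negP; rewrite -ltnNge -{1}(cat_take_drop N.+1 s) count_cat.
  rewrite ltn_addr// (_ : count _ _ = size (take N.+1 s)).
    by rewrite sz_take.
  apply/eqP; rewrite -all_count; apply/(all_nthP 0) => i.
  rewrite sz_take ltnS => le_iN; rewrite nth_take//.
  rewrite subr_lt0 (le_lt_trans _ lt_E)// le_s// ?sz_s; lia.
Qed.

Lemma card_odd_ord (N : nat) : #|[set i : 'I_N.*2.+1 | odd i]%SET| = N.
Proof.
have -> : #|[set i : 'I_N.*2.+1 | odd i]%SET| = (\sum_(i < N.*2.+1) odd i)%N.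
  rewrite cardsE -sum1_card big_mkcond; apply: eq_bigr => i _.
  by rewrite unfold_in; case: (odd i).
elim: N => [|N IH]; first by rewrite big_ord1.
rewrite doubleS 2!big_ord_recr/= odd_double addn0 addn1; congr _.+1; exact: IH.
Qed.

Section band.
Variables (R : realType) (N : nat) (v : 'rV[R]_(N.*2.+1)).
Local Notation E := (v 0 (site N 1)).

(** The 0-based even indices are the N + 1 odd sites; no bond joins two of them,
    so they form an isotropic block for J_a - E, with N sites outside. *)
Lemma lambda0_const (a : R) :
  (forall k, (k <= N)%N -> v 0 (inord k.*2) = E) -> lambda v 0 a = E.
Proof.
move=> vE; have symJ := trmx_Jmx v a.
have [s_sorted _] := symmetric_eigenvalues_seqP symJ.
rewrite /lambda addr0 absz_nat.
pose Z := [set i : 'I_N.*2.+1 | ~~ odd i]%SET.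
have cZ : #|~: Z| = N.
  rewrite -[RHS]card_odd_ord; apply: eq_card => i.
  by rewrite !inE negbK.
have JZ i j : i \in Z -> j \in Z -> Jmx v a i j = if i == j then E else 0.
  rewrite !inE => iZ jZ; rewrite mxE; case: eqP => [_|_].
    rewrite -(vE i./2); last by have := ltn_ord i; lia.
    by congr (v _ _); apply/val_inj; rewrite /= inordK; have := ltn_ord i; lia.
  case: eqP => [e|_]; first by move: jZ; rewrite e /= iZ.
  by case: eqP => [e|//]; move: iZ; rewrite e /= jZ.
apply: sorted_median => //; first exact: size_eigenvalues_seq.
  rewrite -[leqRHS]cZ.
  rewrite (leq_trans _ (count_eigenvalues_isotropic 1 symJ JZ))//.
  by apply/eq_leq/eq_count => x /=; rewrite mul1r.
rewrite -[leqRHS]cZ.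
rewrite (leq_trans _ (count_eigenvalues_isotropic (- 1) symJ JZ))//.
by apply/eq_leq/eq_count => x /=; rewrite mulN1r oppr_gt0.
Qed.

End band.

(** * The determinant of J_a - E as a polynomial in a *)

Section continuant.
Variables (F : fieldType) (w : nat -> F).

(** The off-diagonal entry (k, k + 1) of J_a, as a polynomial in a. *)
Definition bond (k : nat) : {poly F} := if odd k then 1 else 'X.

(** The recurrence has two terms of memory: the pair holds the minors of orders
    k and k + 1. *)
Fixpoint continuant2 (k : nat) : {poly F} * {poly F} :=
  if k is k'.+1 then
    let: (d, d') := continuant2 k' in
    (d', w k *: d' - bond k' ^+ 2 * d)
  else (1, (w 0)%:P).

(** The leading principal minor of order k of the tridiagonal matrix with
    diagonal w and off-diagonal entries [bond]. *)
Definition continuant k := (continuant2 k).1.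

Lemma continuant0 : continuant 0 = 1. Proof. by []. Qed.
Lemma continuant1 : continuant 1 = (w 0)%:P. Proof. by []. Qed.
Lemma continuantSS k :
  continuant k.+2 = w k.+1 *: continuant k.+1 - bond k ^+ 2 * continuant k.
Proof. by rewrite /continuant/=; case: (continuant2 k). Qed.

(** In order 2m as in order 2m + 1, exactly m bonds have weight a and they are
    pairwise disjoint, so the degree is at most 2m. In order 2m they form a
    perfect matching, whose contribution a^(2m), up to sign, is the leading
    term. *)
Lemma size_continuant m :
  size (continuant m.*2) = m.*2.+1 /\ (size (continuant m.*2.+1) <= m.*2.+1)%N.
Proof.
elim: m => [|m [IH0 IH1]].
  by rewrite /continuant/= size_poly1 size_polyC_leq1.
rewrite doubleS.
have sz2 : size (continuant m.*2.+2) = m.*2.+3.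
  rewrite continuantSS /bond odd_double addrC size_polyDl size_polyN.
    by rewrite mulrC size_mulXn ?IH0// -size_poly_eq0 IH0.
  rewrite mulrC size_mulXn ?IH0 -?size_poly_eq0 ?IH0//.
  by rewrite (leq_ltn_trans (size_scale_leq _ _))// (leq_ltn_trans IH1)//; lia.
split => //; rewrite continuantSS /bond /= odd_double/= expr1n mul1r.
rewrite (leq_trans (size_polyD _ _))// size_polyN geq_max.
rewrite (leq_trans (size_scale_leq _ _)) ?sz2//=.
by rewrite (leq_trans IH1)//; lia.
Qed.

(** If the minor of order 2m + 3 vanishes, then w_(2m+2) D_(2m+2) = D_(2m+1),
    where the left-hand side would have the larger degree unless w_(2m+2) = 0;
    the minor of order 2m + 1 then vanishes as well. *)
Lemma continuant_eq0 m : continuant m.*2.+1 = 0 ->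
  forall k, (k <= m)%N -> w k.*2 = 0.
Proof.
elim: m => [|m IH].
  by rewrite continuant1 => /eqP; rewrite polyC_eq0 => /eqP w0 [|].
rewrite doubleS continuantSS /bond /= odd_double/= expr1n mul1r.
move/subr0_eq => e.
have w0 : w m.*2.+2 = 0.
  apply/eqP; apply: contraT => w0.
  have [_] := size_continuant m; rewrite -e size_scale//.
  have [+ _] := size_continuant m.+1; rewrite doubleS => ->; lia.
move: e; rewrite w0 scale0r => /esym/IH {}IH k.
by rewrite leq_eqVlt ltnS => /predU1P[->|/IH//]; rewrite doubleS.
Qed.

End continuant.

Section tridiagonal.
Variables (R : realType) (N : nat) (v : 'rV[R]_(N.*2.+1)).
Local Notation p := N.*2.+1.

(** The coordinates of u, extended by zero so that the eigenvalue equation has the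
    same form at the last site as at the others. *)
Definition entry (u : 'rV[R]_p) (k : nat) : R :=
  if (k < p)%N then u 0 (inord k) else 0.

Lemma mulmx_Jmx (a : R) (u : 'rV[R]_p) (j : 'I_p) :
  (u *m Jmx v a) 0 j =
    (if (0 < j)%N then (if odd j.-1 then 1 else a) * entry u j.-1 else 0)
    + v 0 j * u 0 j + (if odd j then 1 else a) * entry u j.+1.
Proof.
have -> : (u *m Jmx v a) 0 j =
    \sum_(i < p) (if i.+1 == j then (if odd j.-1 then 1 else a) * entry u i else 0)
  + \sum_(i < p) (if i == j :> nat then v 0 j * u 0 j else 0)
  + \sum_(i < p) (if i == j.+1 :> nat then (if odd j then 1 else a) * entry u i
                  else 0).
  rewrite -!big_split mxE; apply: eq_bigr => i _ /=.
  have entry_i : entry u i = u 0 i by rewrite /entry ltn_ord inord_val.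
  rewrite mxE entry_i; have [->|ne_ij] := eqVneq i j.
    by rewrite eqxx (gtn_eqF (ltnSn j)) (ltn_eqF (ltnSn j)) add0r addr0 mulrC.
  rewrite (_ : (i == j :> nat) = false); last exact: negbTE ne_ij.
  rewrite addr0 eq_sym; have [e|_] := eqVneq (i.+1 : nat) j.
    by rewrite -e (ltn_eqF (leqW (ltnSn i))) addr0 mulrC.
  by rewrite add0r; case: eqP => _; rewrite ?mulr0// mulrC.
rewrite -!big_mkcond/=; congr (_ + _ + _).
- case: j => -[|j] lt_j /=; first by rewrite big_pred0.
  under eq_bigl do rewrite eqSS.
  rewrite (big_ord1_eq _ (fun i => (if odd j then 1 else a) * entry u i)).
  by rewrite ltnW.
- by rewrite (big_ord1_eq _ (fun=> v 0 j * u 0 j)) ltn_ord.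
- rewrite (big_ord1_eq _ (fun i => (if odd j then 1 else a) * entry u i)).
  by case: ifPn => // jp; rewrite /entry (negbTE jp) mulr0.
Qed.

(** Solving (J_a - E) u = 0 from the first coordinate onwards gives u_k as a
    multiple of D_k u_0; the last equation says that the coordinate after the
    last one is zero, that is D_p u_0 = 0. As no bond vanishes, u_0 = 0 would
    force u = 0. This shows that det(J_a - E) = 0 without expanding a
    determinant. *)
Lemma eigenvalue_root_continuant (E a : R) : a != 0 -> eigenvalue (Jmx v a) E ->
  root (continuant (fun k => v 0 (inord k) - E) p) a.
Proof.
move=> a0 /eigenvalueP[u uJ u0].
set w := fun k => _; pose D k := (continuant w k).[a].
pose b k : R := if odd k then 1 else a.
have b0 k : b k != 0 by rewrite /b; case: odd; rewrite ?oner_eq0.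
have rec0 : b 0 * entry u 1 = - (w 0 * entry u 0).
  have /rowP/(_ (inord 0)) := uJ; rewrite mulmx_Jmx mxE inordK//=.
  by rewrite /w /b [entry u 0]/entry /= => e; lra.
have recS k : (k.+1 < p)%N ->
    b k.+1 * entry u k.+2 = - (w k.+1 * entry u k.+1) - b k * entry u k.
  move=> lt_k; have /rowP/(_ (inord k.+1)) := uJ.
  rewrite mulmx_Jmx mxE inordK//= -/(b k) -/(b k.+1).
  by rewrite /w [entry u k.+1]/entry lt_k => e; lra.
have claim k : (k <= p)%N ->
    entry u k * \prod_(i < k) b i = (- 1) ^+ k * D k * entry u 0.
  move: k; apply: ltn_ind => -[|[|k]] IH le_k.
  - by rewrite big_ord0 expr0 /D continuant0 hornerC !mulr1 mul1r.
  - by rewrite big_ord1 /D continuant1 hornerC mulrC rec0; ring.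
  have := IH k.+1 (leqnn _) (ltnW le_k).
  have := IH k (leqnSn _) (ltnW (ltnW le_k)).
  rewrite !big_ord_recr /= => IHk IHk1.
  have hb : (bond R k).[a] = b k.
    by rewrite /bond /b; case: odd; rewrite ?hornerC ?hornerX.
  have -> : D k.+2 = w k.+1 * D k.+1 - b k ^+ 2 * D k.
    by rewrite /D continuantSS hornerD hornerN hornerM hornerZ horner_exp hb.
  transitivity ((b k.+1 * entry u k.+2) * (\prod_(i < k) b i * b k)); first by ring.
  rewrite recS//.
  transitivity (- w k.+1 * (entry u k.+1 * (\prod_(i < k) b i * b k))
               - b k ^+ 2 * (entry u k * \prod_(i < k) b i)); first by ring.
  by rewrite IHk IHk1 !exprS; ring.
have u0_neq0 : entry u 0 != 0.
  apply: contra_neq u0 => u_0; apply/rowP => i; rewrite [RHS]mxE.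
  have := claim i (ltnW (ltn_ord i)); rewrite u_0 mulr0 => /eqP; rewrite mulf_eq0.
  have /negPf-> : \prod_(l < i) b l != 0 by apply/prodf_neq0.
  by rewrite orbF /entry ltn_ord inord_val => /eqP.
have := claim p (leqnn _); rewrite {1}/entry ltnn mul0r => /esym/eqP.
by rewrite !mulf_eq0 (negbTE u0_neq0) orbF signr_eq0.
Qed.

Lemma constant_of_lambda0 (E : R) :
  (forall a : R, 0 <= a <= 2 -> lambda v 0 a = E) ->
  forall k, (k <= N)%N -> v 0 (inord k.*2) = E.
Proof.
move=> lamE k le_kN; apply/eqP; rewrite -subr_eq0; apply/eqP.
pose w k := v 0 (inord k) - E; rewrite -/(w k.*2).
apply: continuant_eq0 le_kN; apply/eqP; apply: contraT => c0.
have root_c a : 0 < a <= 2 -> root (continuant w p) a.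
  move=> /andP[a_gt0 a_le2]; apply: eigenvalue_root_continuant.
    by rewrite gt_eqF.
  have symJ := trmx_Jmx v a.
  rewrite eigenvalue_root_char (symmetric_eigenvalues_seqP symJ).2 root_prod_XsubC.
  rewrite -(lamE a); last by rewrite ltW.
  by rewrite /lambda addr0 absz_nat mem_nth// size_eigenvalues_seq//; lia.
(* The points 1 / (i + 1) are as many roots in ]0, 2] as needed. *)
pose r := [seq (i.+1%:R : R)^-1 | i <- iota 0 (size (continuant w p))].
suff : (size r < size (continuant w p))%N by rewrite size_map size_iota ltnn.
apply: max_poly_roots => //.
  apply/allP => _ /mapP[i _ ->]; apply: root_c.
  by rewrite invr_gt0 ltr0n/= (@le_trans _ _ 1) ?ler1n// invf_le1 ?ler1n//.
rewrite map_inj_uniq ?iota_uniq// => i j /invr_inj/eqP.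
by rewrite eqr_nat => /eqP[].
Qed.

End tridiagonal.

(** * Square sums *)

Section sumsq.
Variable R : realType.
Local Notation C := R[i].
Implicit Types I J : choiceType.

(** The square of [l2norm]: its bounds are linear in this square, so that square
    roots are only taken at the end. *)
Definition sumsq I (f : I -> C) : \bar R :=
  \esum_(x in [set: I]) (normc (f x) ^+ 2)%:E.

Lemma sumsq_ge0 I (f : I -> C) : (0 <= sumsq f)%E.
Proof. by apply: esum_ge0 => x _; rewrite lee_fin sqr_ge0. Qed.

Lemma l2normE I (f : I -> C) : l2norm f = sqrte (sumsq f).
Proof. by []. Qed.

Lemma l2E I (f : I -> C) : l2 I f <-> (sumsq f < +oo)%E.
Proof.
rewrite /l2 /= l2normE; have := sumsq_ge0 f.
by case: (sumsq f) => //= r _; rewrite !ltry.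
Qed.

Lemma l2norm_le_of_sumsq I J (f : I -> C) (g : J -> C) (K : R) :
  0 <= K -> (sumsq f <= (K ^+ 2)%:E * sumsq g)%E ->
  (l2norm f <= K%:E * l2norm g)%E.
Proof.
move=> K0 le_fg; have K20 : (0 <= (K ^+ 2)%:E :> \bar R)%E by rewrite lee_fin sqr_ge0.
rewrite (_ : K%:E = sqrte (K ^+ 2)%:E); last by rewrite /= sqrtr_sqr ger0_norm.
by rewrite !l2normE -sqrteM// lee_sqrt// mule_ge0// sumsq_ge0.
Qed.

Lemma normc_ge0 (z : C) : 0 <= normc z.
Proof. by case: z => a b; exact: sqrtr_ge0. Qed.

Lemma sumsqZ I (c : C) (f : I -> C) :
  (sumsq (fun x => c * f x)%R <= (normc c ^+ 2)%:E * sumsq f)%E.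
Proof.
apply: ge_ereal_sup => _ [X [finX XI] <-].
under eq_fsbigr do rewrite Normc.normcM exprMn EFinM.
rewrite -ge0_mule_fsumr; last by move=> x; rewrite lee_fin sqr_ge0.
rewrite lee_wpmul2l ?lee_fin ?sqr_ge0//.
by apply: esum_ge; exists X.
Qed.

Lemma sumsqD I (f g : I -> C) :
  (sumsq (fun x => f x + g x)%R <= 2%:E * (sumsq f + sumsq g))%E.
Proof.
pose n2 (h : I -> C) x := (normc (h x) ^+ 2)%:E : \bar R.
have n2_ge0 h x : [set: I] x -> (0 <= n2 h x)%E by rewrite lee_fin sqr_ge0.
have n2D_ge0 x : [set: I] x -> (0 <= n2 f x + n2 g x)%E.
  by move=> _; rewrite adde_ge0 ?n2_ge0.
have two : (1 + 1 = 2 :> R) by [].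
rewrite -two EFinD ge0_muleDl// mul1e -(esumD (n2_ge0 f) (n2_ge0 g)).
rewrite -(esumD n2D_ge0 n2D_ge0); apply: le_esum => x _.
rewrite -!EFinD lee_fin.
have := le_normcD (f x) (g x).
have := normc_ge0 (f x + g x).
move: (normc (f x + g x)) (normc (f x)) (normc (g x)) => a b c.
move=> a0 le_abc.
have : a ^+ 2 <= (b + c) ^+ 2.
  by apply: lerXn2r; rewrite ?nnegrE // (le_trans a0 le_abc).
by have := sqr_ge0 (b - c); nra.
Qed.

Lemma sumsq_inj I J (e : I -> J) (f : J -> C) :
  injective e -> (sumsq (f \o e) <= sumsq f)%E.
Proof.
move=> inj_e.
rewrite /sumsq -(esum_image _ e (fun x => (normc (f x) ^+ 2)%:E)); last first.
  by move=> x y _ _; exact: inj_e.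
rewrite esum_mkcond; apply: le_esum => x _.
by case: ifP => // _; rewrite lee_fin sqr_ge0.
Qed.

(** A finite set carrying the sum up to eps leaves less than eps to the
    complement of any larger one. *)
Lemma sumsq_tail I (f : I -> C) (eps : R) : (sumsq f < +oo)%E -> 0 < eps ->
  exists A : {fset I}, forall F : {fset I}, (A `<=` F)%fset ->
    (sumsq (fun x => if x \in F then 0 else f x)%R < eps%:E)%E.
Proof.
move=> fin_f eps0.
have f_fin : sumsq f \is a fin_num by rewrite ge0_fin_numE ?sumsq_ge0.
have [_ [X [finX _] <-] ltX] := ub_ereal_sup_adherent eps0 f_fin.
exists (fset_set X) => F leXF.
pose a x := (normc (f x) ^+ 2)%:E : \bar R.
have a0 x : (0 <= a x)%E by rewrite lee_fin sqr_ge0.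
have eF : sumsq f = (\esum_(x in setT `&` [set` F]) a x
      + \esum_(x in setT `&` ~` [set` F]) a x)%E.
  by apply: esumID => x _; exact: a0.
have -> : sumsq (fun x => if x \in F then 0 else f x)
    = (\esum_(x in setT `&` ~` [set` F]) a x)%E.
  rewrite esum_mkcondr; apply: eq_esum => x _; rewrite in_setC mem_setE.
  by case: (x \in F) => //; rewrite Normc.normc0 expr0n.
have leF : (sumsq f - eps%:E < \esum_(x in setT `&` [set` F]) a x)%E.
  apply: (lt_le_trans ltX); rewrite setTI; apply: esum_ge; exists X => //.
  by split => // x Xx; apply: (fsubsetP leXF); rewrite in_fset_set// inE.
move: f_fin leF; rewrite eF.
set S := esum (_ `&` [set` F]) _; set T := esum (_ `&` ~` _) _.
rewrite fin_numD => /andP[].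
case: S => // s _; case: T => // t _.
by rewrite -EFinD -EFinB !lte_fin; lra.
Qed.

End sumsq.

Lemma sumsq_columns (R : realType) (I : choiceType) (J : finType)
    (f : I * J -> R[i]) :
  sumsq f = (\sum_(k : J) sumsq (fun n => f (n, k)))%E.
Proof.
pose a x := (normc (f x) ^+ 2)%:E : \bar R.
have a0 x : (0 <= a x)%E by rewrite lee_fin sqr_ge0.
transitivity (\esum_(x in [set: I * J])
               (\sum_(k : J) if x.2 == k then a x else 0%E))%E.
  by apply: eq_esum => x _; rewrite -big_mkcond/= (big_pred1 x.2).
rewrite esum_sum; last by move=> x k _ _; case: ifP.
apply: eq_bigr => k _.
rewrite /sumsq -(esum_image _ (fun n => (n, k)) a); last by move=> m n _ _ [].
rewrite [RHS]esum_mkcond; apply: eq_esum => -[n l] _ /=.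
have [->|ne_lk] := eqVneq l k; first by rewrite mem_set//=; exists n.
by rewrite memNset// => -[m _ [_ e]]; rewrite e eqxx in ne_lk.
Qed.

Section shift.
Variable R : realType.
Local Notation C := R[i].
Implicit Types h g : int -> C.

Lemma negIS_linear (c : C) h g :
  negIS (fun n => c * h n + g n) = (fun n => c * negIS h n + negIS g n).
Proof. by apply/funext => n; rewrite /negIS; ring. Qed.

Lemma iter_negIS_linear k (c : C) h g :
  iter k (@negIS R) (fun n => c * h n + g n)
    = (fun n => c * iter k (@negIS R) h n + iter k (@negIS R) g n).
Proof. by elim: k => //= k ->; exact: negIS_linear. Qed.

(** |x + y|^2 <= 2 (|x|^2 + |y|^2) and the invariance of the sum under the
    shift. *)
Lemma sumsq_negIS h : (sumsq (negIS h) <= 4%:E * sumsq h)%E.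
Proof.
apply: (le_trans (sumsqD (fun n => - h n) (fun n => - h (n + 1)))).
have -> : sumsq (fun n => - h n) = sumsq h.
  by apply: eq_esum => n _; rewrite normcN.
have -> : (4%:E = 2%:E * 2%:E :> \bar R)%E by rewrite -EFinM; congr (_%:E); ring.
rewrite -muleA lee_wpmul2l ?lee_fin//.
have -> : (2%:E * sumsq h = sumsq h + sumsq h)%E.
  by rewrite (_ : 2 = 1 + 1)// EFinD ge0_muleDl// mul1e.
rewrite leeD2l// (_ : sumsq _ = sumsq (h \o (+%R^~ 1))).
  by apply: sumsq_inj; exact: addIr.
by apply: eq_esum => n _; rewrite normcN.
Qed.

Lemma sumsq_iter_negIS k h :
  (sumsq (iter k (@negIS R) h) <= (4 ^+ k)%:E * sumsq h)%E.
Proof.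
elim: k => [|k IH]; first by rewrite expr0 mul1e.
rewrite exprS EFinM -muleA (le_trans (sumsq_negIS _))//.
by rewrite lee_wpmul2l// lee_fin.
Qed.

(** The modulus of g is constant, and a nonzero constant is not summable over
    the integers. *)
Lemma l2_antiperiodic g : l2 int g -> (forall n, g (n - 1) + g n = 0) ->
  g = (fun=> 0).
Proof.
move=> /l2E fin_g anti.
have g_const n : normc (g n) = normc (g 0).
  have step m : normc (g (m - 1)) = normc (g m).
    by rewrite -[RHS]normcN; congr normc; apply/eqP; rewrite -addr_eq0 anti.
  elim: n => [//|n <-|n <-]; first by rewrite -step -natz -addn1 natrD addrK natz.
  by rewrite -(step (- n%:Z)); congr (normc (g _)); lia.
suff g0 : normc (g 0) = 0.
  by apply/funext => n; apply: Normc.eq0_normc; rewrite g_const.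
apply/eqP; apply: contraT => g0.
have c_gt0 : 0 < normc (g 0) ^+ 2 by rewrite exprn_even_gt0.
have [A /(_ A (fsubset_refl _))] := sumsq_tail fin_g c_gt0.
rewrite ltNge => /negP[].
(* Larger than the absolute values of all the elements of A. *)
pose m : int := (\sum_(x <- A) `|x|%N).+1.
have mA : m \notin A.
  apply/negP => mA; have : (`|m| <= \sum_(x <- A) `|x|)%N.
    by rewrite (big_rem m)//= leq_addr.
  by rewrite absz_nat ltnn.
apply: esum_ge; exists [set m]; first by split.
by rewrite fsbig_set1 (negbTE mA) g_const.
Qed.

End shift.

(** * The states carried by the odd sites *)

Section flat_states.
Local Open Scope complex_scope.
Variables (R : realType) (N : nat).
Local Notation C := R[i].
Local Notation p := N.*2.+1.
Implicit Types (h : int -> C) (f : Gamma N -> C).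

(** The odd sites of the nanoribbon are the even indices, counted from 0: the
    site 2k + 1 has index 2k, where the component is (-I-S)^k h. *)
Definition flat_state h : Gamma N -> C := fun x =>
  if odd x.2 then 0 else iter x.2./2 (@negIS R) h x.1.

Lemma psiE m : psi R N m = flat_state (delta R m).
Proof.
apply/funext => x; rewrite /psi /flat_state /= if_neg; case: ifPn => // x2.
by rewrite uphalf_half (negbTE x2) add0n.
Qed.

Lemma flat_state_even h n k : (k <= N)%N ->
  flat_state h (n, inord k.*2) = iter k (@negIS R) h n.
Proof.
by move=> le_kN; rewrite /flat_state /= inordK ?ltnS ?leq_double// odd_double doubleK.
Qed.

Lemma flat_state_odd h n k : (k < N)%N -> flat_state h (n, inord k.*2.+1) = 0.
Proof.
by move=> lt_kN; rewrite /flat_state /= inordK ?ltnS ?ltn_double//= odd_double.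
Qed.

Lemma Gamma_ext f f' :
  (forall n k, (k <= N)%N -> f (n, inord k.*2) = f' (n, inord k.*2)) ->
  (forall n k, (k < N)%N -> f (n, inord k.*2.+1) = f' (n, inord k.*2.+1)) ->
  f = f'.
Proof.
move=> even odd_; apply/funext => -[n i]; have lt_i := ltn_ord i.
have [i_odd|i_even] := boolP (odd i).
  by have := odd_ n i./2; rewrite (_ : i./2.*2.+1 = i) ?inord_val; [apply; lia|lia].
by have := even n i./2; rewrite (_ : i./2.*2 = i) ?inord_val; [apply; lia|lia].
Qed.

Lemma coeffs_flat_state h : coeffs (flat_state h) = h.
Proof. by apply/funext => n; rewrite /coeffs (flat_state_even h n (leq0n N)). Qed.

Lemma flat_state_linear (c : C) h g :
  flat_state (fun n => c * h n + g n)
    = (fun x => c * flat_state h x + flat_state g x).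
Proof.
apply/funext => x; rewrite /flat_state; case: ifP => _; first by rewrite mulr0 addr0.
by rewrite iter_negIS_linear.
Qed.

(** Bounds the sum over the sites of the factors 4^k by which [sumsq] grows under
    (-I-S)^k. Since it is at least 1, it also bounds its own square root, and so
    serves for the norms as well as for their squares. *)
Definition flat_const : R := \sum_(k < p) 4 ^+ k.

Lemma flat_const_ge1 : 1 <= flat_const.
Proof. by rewrite /flat_const big_ord_recl expr0 lerDl sumr_ge0. Qed.

Lemma sumsq_flat_state h :
  (sumsq (flat_state h) <= flat_const%:E * sumsq h)%E.
Proof.
rewrite sumsq_columns -sumEFin ge0_sume_distrl; last by move=> k _; rewrite lee_fin.
apply: lee_sum => k _; rewrite /flat_state /=; case: (odd k).
  rewrite /sumsq esum1 ?mule_ge0 ?lee_fin ?sumsq_ge0// => n _.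
  by rewrite Normc.normc0 expr0n.
apply: (le_trans (sumsq_iter_negIS _ _)).
rewrite lee_wpmul2r ?sumsq_ge0// lee_fin ler_weXn2l ?ler1n//.
by rewrite -divn2 leq_div.
Qed.

Lemma l2norm_flat_state h :
  (l2norm (flat_state h) <= flat_const%:E * l2norm h)%E.
Proof.
have K1 := flat_const_ge1; have K0 : 0 <= flat_const by rewrite (le_trans _ K1).
apply: l2norm_le_of_sumsq => //; apply: (le_trans (sumsq_flat_state h)).
by rewrite lee_wpmul2r ?sumsq_ge0// lee_fin expr2 ler_peMl.
Qed.

Lemma l2_flat_state h : l2 int h -> l2 (Gamma N) (flat_state h).
Proof.
move=> /l2E fin_h; apply/l2E; apply: (le_lt_trans (sumsq_flat_state h)).
by rewrite lte_mul_pinfty// lee_fin (le_trans _ flat_const_ge1).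
Qed.

Lemma sumsq_column f k : (sumsq (fun n => f (n, k)) <= sumsq f)%E.
Proof. by apply: (sumsq_inj (e := fun n => (n, k)) f) => m n []. Qed.

Lemma l2_column f k : l2 (Gamma N) f -> l2 int (fun n => f (n, k)).
Proof. by move=> /l2E fin_f; apply/l2E/(le_lt_trans _ fin_f)/sumsq_column. Qed.

Lemma l2norm_coeffs f : (l2norm (coeffs f) <= l2norm f)%E.
Proof. by rewrite !l2normE lee_sqrt ?sumsq_ge0// sumsq_column. Qed.

Lemma ext0E f n k : ext0 f n k.+1 = if (k < p)%N then f (n, inord k) else 0.
Proof. by []. Qed.

Variable v : 'rV[R]_p.

(** The equation of H at the site 2k + 1: its neighbours are the even sites, of
    indices 2k - 1 and 2k + 1, missing for k = 0 and for k = N respectively. *)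
Lemma Hop_even f n k : (k <= N)%N ->
  Hop v f (n, inord k.*2) =
    (if k is k'.+1 then f (n, inord k'.*2.+1) else 0)
    + (if (k < N)%N then f (n - 1, inord k.*2.+1) + f (n, inord k.*2.+1) else 0)
    + (v 0 (inord k.*2))%:C * f (n, inord k.*2).
Proof.
move=> le_kN; rewrite /Hop /Delta /= inordK ?ltnS ?leq_double// odd_double/=.
rewrite !ext0E; congr (_ + _); rewrite -addrA ltnS ltn_double.
congr (_ + _); last by case: ifP => _; rewrite ?addr0.
by case: k le_kN => // k lt_kN; rewrite doubleS ext0E ifT//; lia.
Qed.

(** The equation of H at the site 2k + 2, all of whose neighbours exist. *)
Lemma Hop_odd f n k : (k < N)%N ->
  Hop v f (n, inord k.*2.+1) =
    f (n, inord k.*2) + f (n + 1, inord k.*2) + f (n, inord k.*2.+2)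
    + (v 0 (inord k.*2.+1))%:C * f (n, inord k.*2.+1).
Proof.
move=> lt_kN; rewrite /Hop /Delta /= inordK ?ltnS ?ltn_double//= odd_double/=.
by rewrite !ext0E !ifT//; lia.
Qed.

Variable E : R.
Hypothesis vE : forall k, (k <= N)%N -> v 0 (inord k.*2) = E.

(** At the odd sites the potential cancels E, so the equations there involve the
    even components only: from the left end on, each of these is antiperiodic,
    hence zero. What is left of the equations at the even sites is the recurrence
    f_(.,2k+3) = (-I-S) f_(.,2k+1). *)
Lemma eigenspace_flat_state f :
  H_eigenspace v E f <-> l2 (Gamma N) f /\ f = flat_state (coeffs f).
Proof.
split=> -[l2f].
  move=> /funeqP Hf; split => //.
  have even_eq n k : (k <= N)%N ->
      (if k is k'.+1 then f (n, inord k'.*2.+1) else 0)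
      + (if (k < N)%N then f (n - 1, inord k.*2.+1) + f (n, inord k.*2.+1) else 0)
      = 0.
    move=> le_kN; have := Hf (n, inord k.*2).
    by rewrite Hop_even// vE// => /eqP; rewrite -subr_eq0 addrK => /eqP.
  have odd0 k : (k < N)%N -> (fun n => f (n, inord k.*2.+1)) = (fun=> 0).
    elim: k => [|k IH] lt_kN; apply: l2_antiperiodic (l2_column _ l2f) _ => n.
      by have := even_eq n 0 isT; rewrite lt_kN add0r.
    have := even_eq n k.+1 (ltnW lt_kN); rewrite lt_kN.
    by have /funeqP/(_ n)-> := IH (ltnW lt_kN); rewrite add0r.
  apply: Gamma_ext => n k kN; last first.
    by rewrite flat_state_odd//; have /funeqP/(_ n) := odd0 k kN.
  rewrite flat_state_even//; elim: k kN n => [|k IH] kN n //=.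
  have := Hf (n, inord k.*2.+1); rewrite Hop_odd//.
  have /funeqP/(_ n)-> := odd0 k kN; rewrite !mulr0 addr0.
  rewrite !(IH (ltnW kN)) doubleS => /eqP; rewrite addrC addr_eq0 => /eqP->.
  by rewrite /negIS opprD.
move=> ->; split; first exact: l2_flat_state (l2_column _ l2f).
move: (coeffs f) => h; apply: Gamma_ext => n k kN.
  rewrite Hop_even// vE//; case: k kN => [|k] kN.
    by case: ifP => [N0|_]; rewrite ?(flat_state_odd h) ?addr0 ?add0r.
  rewrite (flat_state_odd h n kN) add0r.
  by case: ifP => [N0|_]; rewrite ?(flat_state_odd h) ?addr0 ?add0r.
rewrite Hop_odd// flat_state_odd// !mulr0 addr0.
have even m := flat_state_even h m (ltnW kN).
rewrite -doubleS (flat_state_even h n kN) !even /= /negIS.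
by rewrite addrACA !subrr addr0.
Qed.

End flat_states.
Arguments flat_state {R} N h.

(** * Expansion in compactly supported states *)

Lemma l2_linear (R : realType) (I : choiceType) (c : R[i]%C) (f g : I -> R[i]%C) :
  l2 I f -> l2 I g -> l2 I (fun x => c * f x + g x).
Proof.
move=> /l2E fin_f /l2E fin_g; apply/l2E.
apply: (le_lt_trans (sumsqD (fun x => c * f x) g)).
rewrite lte_mul_pinfty ?lee_fin// lte_add_pinfty//.
apply: (le_lt_trans (sumsqZ c f)).
by rewrite lte_mul_pinfty ?lee_fin ?sqr_ge0.
Qed.

Section expansion.
Variables (R : realType) (N : nat).
Local Notation C := R[i]%C.

Lemma l2_delta (m : int) : l2 int (delta R m).
Proof.
apply/l2E; rewrite (_ : sumsq _ = (\esum_(n in [set m]) 1)%E).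
  by rewrite esum_set1// ltry.
rewrite esum_mkcond; apply: eq_esum => n _; rewrite /delta.
have [->|ne_nm] := eqVneq n m.
  by rewrite mem_set// Normc.normc1 expr1n.
rewrite memNset; last by move=> e; rewrite e eqxx in ne_nm.
by rewrite Normc.normc0 expr0n.
Qed.

Lemma sum_delta (F : {fset int}) (c : int -> C) n :
  \sum_(m <- F) c m * delta R m n = if n \in F then c n else 0.
Proof.
case: ifPn => nF.
  rewrite (bigD1_seq n)//= ?fset_uniq// /delta eqxx mulr1 big1 ?addr0//.
  by move=> m ne_mn; rewrite eq_sym (negbTE ne_mn) mulr0.
rewrite big_seq big1// => m mF; rewrite /delta.
by case: eqP nF mF => [->|_ _ _]; rewrite ?mulr0// => /negP.
Qed.

Lemma flat_state_sum (s : seq int) (c : int -> C) :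
  flat_state N (fun n => \sum_(m <- s) c m * delta R m n)
    = (fun x => \sum_(m <- s) c m * psi R N m x).
Proof.
elim: s => [|m s IH].
  under eq_fun do rewrite big_nil; under [RHS]eq_fun do rewrite big_nil.
  have := flat_state_linear N (-1) (fun=> 0 : C) (fun=> 0).
  under eq_fun do rewrite mulr0 addr0.
  by move=> ->; apply/funext => x; rewrite mulN1r addNr.
under eq_fun do rewrite big_cons; under [RHS]eq_fun do rewrite big_cons.
by rewrite flat_state_linear IH psiE.
Qed.

(** Since psi^m is the flat state of e_m, the remainder of the series is the flat
    state of the remainder of h, whose norm is controlled by that of the tail. *)
Lemma flat_state_expansion (h : int -> C) : l2 int h ->
  l2_sums_to (fun m x => h m * psi R N m x) (flat_state N h).
Proof.
move=> /l2E fin_h; rewrite /l2_sums_to.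
pose tail (F : {fset int}) : int -> C := fun n => if n \in F then 0 else h n.
have tailE (F : {fset int}) :
    (fun x => flat_state N h x - \sum_(m <- F) h m * psi R N m x)
    = flat_state N (tail F).
  apply/funext => x.
  have -> : tail F = (fun n => (-1) * (\sum_(m <- F) h m * delta R m n) + h n).
    by apply/funext => n; rewrite sum_delta /tail; case: ifP => _; ring.
  by rewrite flat_state_linear flat_state_sum; ring.
under eq_fun do rewrite tailE.
have K0 : 0 < flat_const R N by rewrite (lt_le_trans ltr01)// flat_const_ge1.
have small (eps : R) : 0 < eps ->
    \forall F \near summability.totally,
      (l2norm (flat_state N (tail F)) <= eps%:E)%E.
  move=> eps0.
  have [A HA] := sumsq_tail fin_h (exprn_gt0 2 (divr_gt0 eps0 K0)).
  exists A => //= F /HA {}HA; apply: (le_trans (l2norm_flat_state N _)).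
  rewrite -[leRHS]/(eps%:E) -(divfK (lt0r_neq0 K0) eps) mulrC EFinM.
  rewrite lee_wpmul2l ?lee_fin ?(ltW K0)//.
  have -> : (eps / flat_const R N)%:E = sqrte ((eps / flat_const R N) ^+ 2)%:E.
    by rewrite /= sqrtr_sqr ger0_norm// ltW// divr_gt0.
  by rewrite l2normE lee_sqrt ?lee_fin ?sqr_ge0// ltW.
have FF := @summability.totally_filter int.
apply/fine_cvgP; split.
  apply: filterS (small 1 ltr01) => F le1.
  by rewrite ge0_fin_numE ?sqrte_ge0// (le_lt_trans le1)// ltry.
apply/cvgrPdist_le => eps eps0; apply: filterS (small eps eps0) => F /=.
rewrite sub0r normrN.
have : (0 <= l2norm (flat_state N (tail F)))%E by exact: sqrte_ge0.
by case: (l2norm _) => [r||]//; rewrite !lee_fin /= => r0; rewrite ger0_norm.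
Qed.

End expansion.

Section spectrum.
Variables (R : realType) (N : nat) (v : 'rV[R]_(N.*2.+1)).
Local Notation E := (v 0 (site N 1)).
Local Notation odd_const := (forall k, (k <= N)%N -> v 0 (inord k.*2) = E).

Lemma band0_flat : odd_const <-> band v 0 = [set E].
Proof.
split=> [vE|bandE].
  apply/seteqP; split => [_ [a _ <-]|_ ->] /=; first exact: lambda0_const.
  by exists 0; [rewrite /= in_itv /= lexx ler0n|exact: lambda0_const].
apply: constant_of_lambda0 => a a02.
suff : band v 0 (lambda v 0 a) by rewrite bandE.
by exists a.
Qed.

Hypothesis vE : odd_const.

Lemma psi_eigenspace m : H_eigenspace v E (psi R N m).
Proof.
apply/(eigenspace_flat_state vE); rewrite psiE coeffs_flat_state; split => //.
exact/l2_flat_state/l2_delta.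
Qed.

(** The first components of the psi^m are the unit vectors e_m, so any number of
    these functions are independent. *)
Lemma infinite_multiplicity_flat : infinite_multiplicity v E.
Proof.
move=> n; exists (fun i : 'I_n => psi R N i); split.
  by move=> i; exact: psi_eigenspace.
move=> c c0 i; have := c0 ((i : nat)%:Z, site N 1).
rewrite (bigD1 i)//= big1 => [|j ne_ji].
  by rewrite psiE (flat_state_even _ _ (leq0n N)) /= /delta eqxx mulr1 addr0.
rewrite psiE (flat_state_even _ _ (leq0n N)) /= /delta eqz_nat.
by rewrite eq_sym (negbTE (ne_ji : val j != val i)) mulr0.
Qed.

Lemma psi_neq0 m : exists x, psi R N m x != 0.
Proof.
exists (m, site N 1).
by rewrite psiE (flat_state_even _ _ (leq0n N)) /= /delta eqxx oner_neq0.
Qed.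

(** Applying -I-S adds to the support at most its translate by -1. *)
Lemma finite_support_iter_negIS k m :
  finite_set [set n | iter k (@negIS R) (delta R m) n != 0].
Proof.
elim: k => [|k IH] /=.
  apply: (sub_finite_set _ (finite_set1 m)) => n /=.
  by rewrite /delta; have [//|_] := eqVneq n m; rewrite eqxx.
set S := [set n | _] in IH.
apply: (@sub_finite_set _ _ (S `|` [set n - 1 | n in S])); last first.
  by rewrite finite_setU; split=> //; exact: finite_image.
move=> n /=; rewrite /negIS /S.
have [->|nS] := eqVneq (iter k (@negIS R) (delta R m) n) 0.
  by rewrite oppr0 add0r oppr_eq0 => nS; right; exists (n + 1); rewrite ?addrK.
by left.
Qed.

Lemma finite_support_psi m : finite_set [set x | psi R N m x != 0].
Proof.
apply: (@sub_finite_set _ _ (\bigcup_(i in [set: 'I_N.*2.+1])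
    (fun n => (n, i)) @` [set n | iter i./2 (@negIS R) (delta R m) n != 0])).
  move=> [n i] /=; rewrite psiE /flat_state; case: ifP => [_|_ ni].
    by rewrite eqxx.
  by exists i => //; exists n.
apply: bigcup_finite; first exact: finite_finset.
by move=> i _; apply: finite_image; exact: finite_support_iter_negIS.
Qed.

End spectrum.

Theorem theorem1p4 (R : realType) (N : nat) (N_ge1 : (1 <= N)%N)
    (v : 'rV[R]_(N.*2.+1)) :
  let v_ (k : nat) : R := v 0 (site N k) in
  let sigma0 : set R := band v 0 in
  let HH : set (Gamma N -> R[i]) := H_eigenspace v (v_ 1%N) in
  let odd_potential_constant : Prop :=
    forall k : nat, (1 <= k <= N)%N -> v_ k.*2.+1 = v_ 1%N in
  ((flat_band v 0 /\ sigma0 = [set v_ 1%N]) <-> odd_potential_constant) /\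
  ((sigma0 = [set v_ 1%N] /\ is_H_eigenvalue v (v_ 1%N))
     <-> odd_potential_constant) /\
  (sigma0 = [set v_ 1%N] ->
   HH = [set f | l2 (Gamma N) f /\
          exists2 h : int -> R[i], l2 int h &
            (forall k : nat, (k <= N)%N ->
               (fun n : int => f (n, site N k.*2.+1)) = iter k (@negIS R) h) /\
            (forall k : nat, (1 <= k <= N)%N ->
               (fun n : int => f (n, site N k.*2)) = (fun=> 0))]) /\
  (sigma0 = [set v_ 1%N] ->
   (forall m : int,
      HH (psi R N m) /\ finite_set [set x | psi R N m x != 0]) /\
   (forall f, HH f ->
      l2_sums_to (fun m x => coeffs f m * psi R N m x) f) /\
   (* the mapping f |-> coeffs f is a linear bijection of HH onto l^2(Z),
      bounded with a bounded inverse *)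
   (forall (c : R[i]) f g, HH f -> HH g ->
      HH (fun x => c * f x + g x) /\
      coeffs (fun x => c * f x + g x) = (fun m => c * coeffs f m + coeffs g m)) /\
   set_bij HH (l2 int) (@coeffs R N) /\
   (exists2 C : R, 0 < C & forall f, HH f ->
      (l2norm (coeffs f) <= C%:E * l2norm f)%E /\
      (l2norm f <= C%:E * l2norm (coeffs f))%E)).
Proof.
move=> v_ sigma0 HH odd_potential_constant.
pose odd_const := forall k, (k <= N)%N -> v 0 (inord k.*2) = v_ 1%N.
have constE : odd_potential_constant <-> odd_const.
  split=> vE k; last by move=> /andP[_]; exact: vE.
  by case: k => [_|k lt_kN]; [|exact: (vE k.+1)].
have bandE : sigma0 = [set v_ 1%N] <-> odd_const by rewrite -band0_flat.
split.
  rewrite constE -bandE; split=> [[]//|sE]; split=> //.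
  exists (v_ 1%N) => //; apply: infinite_multiplicity_flat; exact/bandE.
split.
  rewrite constE -bandE; split=> [[]//|sE]; split=> //.
  by exists (psi R N 0); [apply: psi_eigenspace; exact/bandE|exact: psi_neq0].
split=> /bandE vE; have HHE := eigenspace_flat_state vE.
  apply/seteqP; split=> f /=.
    move=> /HHE[l2f fE]; split=> //; exists (coeffs f); first exact: l2_column.
    split=> k kN; apply/funext => n; rewrite {1}fE.
      by rewrite /site /= flat_state_even.
    by case: k kN => // k kN; rewrite /site /= flat_state_odd.
  move=> [l2f [h l2h [f_odd f_even]]]; apply/HHE; split=> //.
  have -> : f = flat_state N h.
    apply: Gamma_ext => n k kN.
      by rewrite flat_state_even//; have /funeqP/(_ n) := f_odd k kN.
    by rewrite flat_state_odd//; have /funeqP/(_ n) := f_even k.+1 kN.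
  by rewrite coeffs_flat_state.
have HH_flat h : l2 int h -> HH (flat_state N h).
  move=> l2h; apply/HHE; rewrite coeffs_flat_state; split=> //.
  exact: l2_flat_state.
split; first by move=> m; split; [exact: psi_eigenspace|exact: finite_support_psi].
split.
  move=> f /HHE[l2f fE]; rewrite {2}fE; apply: flat_state_expansion.
  exact: l2_column.
split.
  move=> c f g /HHE[l2f fE] /HHE[l2g gE]; split=> //.
  rewrite fE gE -flat_state_linear; apply: HH_flat.
  apply: l2_linear; exact: l2_column.
split.
  split.
  - by move=> f /HHE[l2f _]; exact: l2_column.
  - move=> f g; rewrite !inE => /HHE[_ fE] /HHE[_ gE] e.
    by rewrite fE gE e.
  - move=> h l2h; exists (flat_state N h); first exact: HH_flat.
    exact: coeffs_flat_state.
have K1 := flat_const_ge1 R N.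
exists (flat_const R N); first by rewrite (lt_le_trans _ K1).
move=> f /HHE[l2f fE]; split; last by rewrite {1}fE l2norm_flat_state.
apply: (le_trans (l2norm_coeffs f)).
by rewrite -[leLHS]mul1e lee_wpmul2r ?sqrte_ge0// lee_fin.
Qed.
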